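(* Let $(A,R)$ be an arbitrary associative unital Rota--Baxter algebra of weight $\theta$ over a field $\mathbb{K}$ of characteristic zero, and let $X\in A$. The Atkinson recursion $F=1+R(F\cdot Xt)$ in $A[[t]]$ is solved by Strichartz' expansion $$F(t)=\exp\Biggl(\sum_{m>0}\ \sum_{\substack{i_1+\cdots+i_n=m\\ i_1,\ldots,i_n>0}}\ m\int_0^tdt_1\int_0^{t_1}dt_2\cdots\int_0^{t_{n-1}}dt_n\ \sum_{\sigma\in S_n}\frac{(-1)^{d(\sigma)}}{n\binom{n-1}{d(\sigma)}}\ t_{\sigma_n}^{i_n-1}\cdots t_{\sigma_1}^{i_1-1}\ \mathfrak{L}_\theta^{(i_1)}(X)\cdots\mathfrak{L}_\theta^{(i_n)}(X)\Biggr),$$ where the inner sum runs over all $n\ge 1$ and all compositions $(i_1,\dots,i_n)$ of $m$, and $d(\sigma)=|\{i<n:\sigma_i>\sigma_{i+1}\}|$ is the number of descents of $\sigma$.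
   Context: A Rota--Baxter algebra of weight $\theta\in\mathbb{K}$ is an associative $\mathbb{K}$-algebra $A$ with a linear map $R:A\to A$ such that $R(x)R(y)=R\bigl(R(x)y+xR(y)+\theta xy\bigr)$. $R$ is extended to $A[[t]]$ coefficientwise ($R(\sum a_nt^n)=\sum R(a_n)t^n$). The left pre-Lie product is $a\triangleright_\theta b:=R(a)b-bR(a)-\theta ba$; $\mathfrak{l}_\theta^{(1)}(X):=X$, $\mathfrak{l}_\theta^{(n+1)}(X):=\mathfrak{l}_\theta^{(n)}(X)\triangleright_\theta X$, and $\mathfrak{L}_\theta^{(n)}(X):=R\bigl(\mathfrak{l}_\theta^{(n)}(X)\bigr)$. The iterated integrals of monomials are formal and equal a rational number times $t^{i_1+\cdots+i_n}$.
   Formalization: The printed formula is false (e.g. A=K, θ=1, R=−id, X=1 fails at t²); the formal theorem drops the factor m before the iterated integrals and takes the product in the reversed order L^(i_n)(X)···L^(i_1)(X). *)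

(* Defs.v *)
From mathcomp Require Import all_boot all_algebra all_fingroup.

Set Implicit Arguments.
Unset Strict Implicit.
Unset Printing Implicit Defensive.

Import GRing.Theory.
Local Open Scope ring_scope.

Section RotaBaxter.
Variables (K : fieldType) (A : algType K).
Implicit Types (theta : K) (R : {linear A -> A}) (x y : A).

Definition rota_baxter theta R : Prop :=
  forall x y, R x * R y = R (R x * y + x * R y + theta *: (x * y)).

Definition prelie theta R (a b : A) : A := R a * b - b * R a - theta *: (b * a).

(* The index is 1-based: [lpow theta R X 0] is junk, set to 0. *)
Fixpoint lpow theta R (X : A) (n : nat) : A :=
  match n with
  | 0 => 0
  | 1 => X
  | n'.+1 => prelie theta R (lpow theta R X n') X
  end.

Definition Lpow theta R (X : A) (n : nat) : A := R (lpow theta R X n).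

End RotaBaxter.

(* A[[t]]: a series is its sequence of coefficients. *)
Definition series (A : Type) := nat -> A.

Section Series.
Variables (K : fieldType) (A : algType K).
Implicit Types (f g : series A).

Definition series1 : series A := fun n => (n == 0%N)%:R.

Definition seriesM f g : series A :=
  fun n => \sum_(k < n.+1) f k * g (n - k)%N.

Definition seriesX f k : series A := iter k (seriesM f) series1.

Definition monomial (a : A) (k : nat) : series A := fun n => a *+ (n == k).

(* \sum_(k >= 0) u_k for a family with t^k dividing u_k: the members of index
   k > n do not contribute to the coefficient of t^n. *)
Definition series_sum (u : nat -> series A) : series A :=
  fun n => \sum_(k < n.+1) u k n.

(* Meaningful when the constant term of [f] is 0. *)
Definition series_exp f : series A :=
  series_sum (fun k => ((k`!)%:R^-1 : K) \*: seriesX f k).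

End Series.

Section Strichartz.
Variable K : fieldType.

(* \int_0^t p(s) ds *)
Definition primitive (p : {poly K}) : {poly K} :=
  \poly_(i < (size p).+1) (p`_i.-1 / i%:R *+ (0 < i)%N).

(* \int_0^t dt_1 \int_0^(t_1) dt_2 ... \int_0^(t_(n-1)) dt_n
     t_1 ^ e_1 * ... * t_n ^ e_n *)
Fixpoint iter_int (e : seq nat) : {poly K} :=
  if e is e1 :: e' then primitive ('X^e1 * iter_int e') else 1.

Definition descents n (s : 'S_n) : nat :=
  #|[set i : 'I_n | [exists j : 'I_n, (val j == i.+1) && (s j < s i)%N]]|.

(* In t_(s_1)^(i_1 - 1) ... t_(s_n)^(i_n - 1) the variable t_k has exponent
   i_(s^-1 k) - 1. *)
Definition strichartz_int n (i : 'I_n -> nat) : {poly K} :=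
  \sum_(s : 'S_n)
    ((-1) ^+ descents s / (n * 'C(n.-1, descents s))%:R)
      *: iter_int [seq (i ((s^-1)%g k)).-1 | k <- enum 'I_n].

(* The parts of a composition of m are at most m, and there are at most m. *)
Definition is_composition m n (i : {ffun 'I_n -> 'I_m.+1}) : bool :=
  [forall j, 0 < i j]%N && (\sum_j i j == m)%N.

Variable A : algType K.
Implicit Types (theta : K) (R : {linear A -> A}) (X : A).

(* The factors come in the order L^(i_n) ... L^(i_1), as do the variables in
   t_(s_n)^(i_n - 1) ... t_(s_1)^(i_1 - 1): since F = 1 + R (F X t) gives
   F' = F L with L = \sum_(i > 0) L^(i) t^(i - 1), the matrix-valued functions
   multiply from the innermost time to the outermost.  The opposite order
   belongs to F' = L F.  The integral is not weighted by m = \sum_j i_j: for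
   n = 1 it is t^m / m, and log F = L^(1) t + L^(2) t^2 / 2 + ... *)
Definition strichartz_term theta R X m n (i : {ffun 'I_n -> 'I_m.+1}) :
    series A :=
  fun N => (strichartz_int (fun j => i j : nat))`_N
             *: \prod_(j < n) Lpow theta R X (i (rev_ord j)).

(* The member of index m is a multiple of t^m; it is 0 for m = 0. *)
Definition strichartz_log theta R X : series A :=
  series_sum (fun m N =>
    \sum_(1 <= n < m.+1)
      \sum_(i : {ffun 'I_n -> 'I_m.+1} | is_composition i)
        strichartz_term theta R X i N).

End Strichartz.

(* Main.v *)
Require Import Defs.
From mathcomp Require Import all_boot all_algebra all_fingroup.
From mathcomp Require Import ring.

Set Implicit Arguments.
Unset Strict Implicit.
Unset Printing Implicit Defensive.

Import GRing.Theory.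
Local Open Scope ring_scope.

(* The coefficients F_n of the solution satisfy n F_n = \sum_i F_(n-i) L^(i),
   so F is the sum over all words (i_1, ..., i_n) of the simplex integral of
   t_1^(i_1 - 1) ... t_n^(i_n - 1) times L^(i_n) ... L^(i_1).  In
   log F = \sum_k (-1)^(k-1) / k (F - 1)^k the coefficient of a word is a sum
   over its cuts into k nonempty blocks of products of simplex integrals.  Such
   a product is the sum of the simplex integrals of the rearrangements by the
   permutations that increase on each block (shuffle formula), that is, whose
   descents lie among the cuts.  Exchanging the sums, a permutation with d
   descents receives \sum_S (-1)^|S| / (|S| + 1) over the sets S of cuts
   containing its descents, which is (-1)^d / (n 'C(n-1, d)). *)

(** * The Atkinson recursion *)

Section Atkinson.
Variables (K : fieldType) (A : algType K) (theta : K) (R : {linear A -> A}).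
Variable X : A.

Fixpoint atkinson n : A := if n is n'.+1 then R (atkinson n' * X) else 1.

Lemma lpowSS n :
  lpow theta R X n.+2 = prelie theta R (lpow theta R X n.+1) X.
Proof. by []. Qed.

(** The definition of [prelie] solved for its first product: moving [X] across [Lpow] raises the
    pre-Lie power by one. *)
Lemma mulr_Lpow n :
  Lpow theta R X n.+1 * X =
    lpow theta R X n.+2 + X * Lpow theta R X n.+1
      + theta *: (X * lpow theta R X n.+1).
Proof. by rewrite lpowSS /prelie /Lpow addrAC !subrK. Qed.

(** Coefficient form of F' = F L. The induction multiplies by [X] on the right; [mulr_Lpow] then
    yields three sums, the three terms of the Rota-Baxter identity for [atkinson (n - i) * X] and
    [lpow theta R X i.+1]. *)
Lemma atkinson_deriv (RB : rota_baxter theta R) n :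
  atkinson n *+ n = \sum_(i < n) atkinson (n - i.+1) * Lpow theta R X i.+1.
Proof.
case: n => [|n]; first by rewrite big_ord0.
elim: n => [|n IHn].
  by rewrite big_ord1 mulr1n /= !mul1r.
have mulS k : (k <= n)%N -> atkinson (n.+1 - k) = R (atkinson (n - k) * X).
  by move=> le_kn; rewrite subSn.
(* This is [n G_n] for [G_n = F_(n-1) X]; the Rota-Baxter identity turns its
   image under [R] into [n F_n]. *)
have eqG : atkinson n.+1 * X *+ n.+2 =
  lpow theta R X n.+2 +
  \sum_(i < n.+1) (atkinson (n.+1 - i) * lpow theta R X i.+1
     + atkinson (n - i) * X * Lpow theta R X i.+1
     + theta *: (atkinson (n - i) * X * lpow theta R X i.+1)).
  rewrite mulrS -mulrnAl IHn mulr_suml.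
  have -> : \sum_(i < n.+1) atkinson (n.+1 - i.+1) * Lpow theta R X i.+1 * X =
    \sum_(i < n.+1) atkinson (n - i) * lpow theta R X i.+2 +
    \sum_(i < n.+1) (atkinson (n - i) * X * Lpow theta R X i.+1
      + theta *: (atkinson (n - i) * X * lpow theta R X i.+1)).
    rewrite -big_split /=; apply: eq_bigr => i _.
    by rewrite subSS -mulrA mulr_Lpow !mulrDr -scalerAr !mulrA -addrA.
  have -> : \sum_(i < n.+1) (atkinson (n.+1 - i) * lpow theta R X i.+1
      + atkinson (n - i) * X * Lpow theta R X i.+1
      + theta *: (atkinson (n - i) * X * lpow theta R X i.+1)) =
    \sum_(i < n.+1) atkinson (n.+1 - i) * lpow theta R X i.+1 +
    \sum_(i < n.+1) (atkinson (n - i) * X * Lpow theta R X i.+1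
      + theta *: (atkinson (n - i) * X * lpow theta R X i.+1)).
    by rewrite -big_split; apply: eq_bigr => i _; rewrite -addrA.
  (* The [lpow] sums differ by a shift: the extra copy [atkinson n.+1 * X] is the term of index 0 on
     the right, and the last term on the left is [lpow theta R X n.+2], as [atkinson 0 = 1]. *)
  rewrite !addrA; congr (_ + _).
  rewrite big_ord_recr big_ord_recl subnn subn0 mul1r addrA [RHS]addrC.
  by congr (_ + _ + _).
rewrite -[LHS]/(R (atkinson n.+1 * X) *+ n.+2) -linearMn eqG linearD raddf_sum.
rewrite [RHS]big_ord_recr /= subnn mul1r [RHS]addrC; congr (_ + _).
apply: eq_bigr => i _; have le_in : (i <= n)%N by rewrite -ltnS.
by rewrite subSS mulS // RB addrC [in RHS]addrC -addrA addrC -addrA.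
Qed.

End Atkinson.

(** * Simplex integrals and the shuffle formula *)

Section Simplex.
Variable K : fieldType.
Hypothesis charK0 : [pchar K] =i pred0.

Lemma natf_eq0 n : (n%:R == 0 :> K) = (n == 0)%N.
Proof. exact: (pcharf0P K).1. Qed.

(* The value at [t = 1] of the iterated integral of the t_k ^ (w_k - 1). *)
Fixpoint simplex_coef (w : seq nat) : K :=
  if w is a :: w' then simplex_coef w' / (a + sumn w')%:R else 1.

Lemma sumn_map_ord n (f : 'I_n -> nat) :
  sumn [seq f k | k <- enum 'I_n] = (\sum_(k < n) f k)%N.
Proof. by rewrite sumnE big_map big_enum. Qed.

Lemma primitiveZXn (a : K) m :
  primitive (a *: 'X^m) = (a / m.+1%:R) *: 'X^(m.+1).
Proof.
apply/polyP => j; rewrite coef_poly !coefZ !coefXn.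
case: j => [|j] /=; first by rewrite !mulr0n mulr0.
rewrite eqSS mulr1n.
case: ltnP => [_|lt_sz].
  by case: eqP => [->|_]; rewrite ?mulr1 ?mulr0 ?mul0r.
(* The index lies beyond the range of [primitive]; for [j = m] this forces [a = 0]. *)
case: eqP => [jm|_]; last by rewrite mulr0.
have := leq_sizeP _ _ lt_sz j (leqnn j).
by rewrite jm coefZ coefXn eqxx mulr1 => ->; rewrite mul0r mulr1.
Qed.

Lemma iter_int_pred (w : seq nat) : all (leq 1) w ->
  iter_int K (map predn w) = simplex_coef w *: 'X^(sumn w).
Proof.
elim: w => [|[|a] w IHw] //= => [_|posw]; first by rewrite scale1r.
by rewrite IHw // -scalerAr -exprD primitiveZXn.
Qed.

(** * The shuffle formula for positions grouped by labels *)

Definition first_of_label n (b : 'I_n -> nat) (p : 'I_n) :=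
  [forall j : 'I_n, (j < p)%N ==> (b j != b p)].

Definition increasing_on_labels n (b : 'I_n -> nat) (s : 'S_n) :=
  [forall i : 'I_n, forall j : 'I_n, (i < j)%N && (b i == b j) ==> (s i < s j)%N].

(** The denominator at [j] in the simplex integral of the subword formed by the class of [j], the
    positions with its label. *)
Definition label_tail n (x b : 'I_n -> nat) (j : 'I_n) :=
  (\sum_(k < n | (j <= k)%N && (b k == b j)) x k)%N.

(** The tail at the first position of a class is the sum over the whole class; [f] sends each
    position to the first one of its class. *)
Lemma sum_first_of_label n (x b : 'I_n -> nat) :
  (\sum_(p < n | first_of_label b p) label_tail x b p = \sum_(j < n) x j)%N.
Proof.
pose f (j : 'I_n) : 'I_n := [arg min_(p < j | b p == b j) (p : nat)].
have fP j : first_of_label b (f j).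
  rewrite /f; case: arg_minnP => // p /eqP bp minp.
  apply/forallP => k; apply/implyP => lt_kp; apply/negP => /eqP bk.
  by have := minp k; rewrite bk bp eqxx leqNgt lt_kp => /(_ isT).
rewrite [RHS](partition_big f (first_of_label b)) //=.
apply: eq_bigr => p /forallP first_p; apply: eq_bigl => j.
rewrite /f; case: arg_minnP => // q /eqP bq minq.
apply/andP/eqP => [[le_pj /eqP bj]|<-]; last by rewrite minq ?bq ?eqxx.
apply/val_inj/eqP; rewrite /= eqn_leq minq ?bj // leqNgt; apply/negP => lt_qp.
by have := first_p q; rewrite lt_qp bq bj eqxx.
Qed.

(** A permutation sending [p] to 0 restricts to a bijection between the complements of [p] and 0,
    hence is a unique [lift_perm p ord0 s]. *)
Lemma big_lift_perm n p (P : pred 'S_n.+1) (F : 'S_n.+1 -> K) :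
  \sum_(s : 'S_n.+1 | P s && (s^-1%g ord0 == p)) F s =
    \sum_(s : 'S_n | P (lift_perm p ord0 s)) F (lift_perm p ord0 s).
Proof.
have lift_perm_inj : injective (lift_perm p ord0 : 'S_n -> _).
  move=> s1 s2 eq_s; apply/permP => k; apply: (@lift_inj _ ord0).
  by rewrite -!(lift_perm_lift p) eq_s.
have lift_perm_onto (s : 'S_n.+1) :
    s p = ord0 -> exists s', s = lift_perm p ord0 s'.
  move=> sp0; have /fin_all_exists[f fE] (k : 'I_n) :
      exists l, s (lift p k) = lift ord0 l.
    case: (unliftP ord0 (s (lift p k))) => [l ->|]; first by exists l.
    by rewrite -sp0 => /perm_inj/eqP; rewrite eq_sym (negPf (neq_lift _ _)).
  have f_inj : injective f.
    move=> k1 k2 eq_f; apply: (@lift_inj _ p); apply: (@perm_inj _ s).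
    by rewrite !fE eq_f.
  exists (perm f_inj); apply/permP => k; case: (unliftP p k) => [k'|] ->.
    by rewrite lift_perm_lift permE fE.
  by rewrite lift_perm_id.
transitivity (\sum_(s in lift_perm p ord0 @: [set s | P (lift_perm p ord0 s)]) F s).
  apply: eq_bigl => s; apply/andP/imsetP => [[Ps /eqP sp]|[s']].
    have [|s' def_s] := lift_perm_onto s; first by rewrite -sp permKV.
    by exists s'; rewrite // inE -def_s.
  by rewrite inE => Ps' ->; rewrite lift_permV lift_perm_id.
rewrite big_imset => [|s1 s2 _ _ /lift_perm_inj //].
by apply: eq_bigl => s; rewrite inE.
Qed.

(** [p] takes the least value, so no earlier position may share its label; pairs avoiding [p]
    compare as before because [lift] is increasing. *)
Lemma increasing_lift_perm n (b : 'I_n.+1 -> nat) p (s : 'S_n) :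
  increasing_on_labels b (lift_perm p ord0 s) =
    first_of_label b p && increasing_on_labels (b \o lift p) s.
Proof.
apply/idP/andP => [incs|[/forallP firstp /forallP incs]].
  split; apply/forallP => i.
    apply/implyP => lt_ip; apply/negP => bip.
    have /forallP/(_ p) := forallP incs i.
    by rewrite lt_ip bip lift_perm_id.
  apply/forallP => j; apply/implyP => /andP[lt_ij bij].
  have /forallP/(_ (lift p j)) := forallP incs (lift p i).
  rewrite !lift_perm_lift bij !lift0 ltnS andbT.
  by rewrite ltnNge leq_bump2 -ltnNge lt_ij.
apply/forallP => i; apply/forallP => j; apply/implyP => /andP[lt_ij bij].
case: (unliftP p j) lt_ij bij => [j'|] -> lt_ij bij; last first.
  by have := firstp i; rewrite lt_ij bij.
case: (unliftP p i) lt_ij bij => [i'|] -> lt_ij bij; last first.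
  by rewrite lift_perm_id lift_perm_lift lift0.
rewrite !lift_perm_lift !lift0 ltnS.
have /forallP/(_ j')/implyP := incs i'; apply.
by rewrite /= bij andbT ltnNge -(leq_bump2 p) -ltnNge.
Qed.

(** The first position of a class lies in no tail but its own, so its removal changes no other
    tail. *)
Lemma label_tail_lift n (x b : 'I_n.+1 -> nat) p j : first_of_label b p ->
  label_tail (x \o lift p) (b \o lift p) j = label_tail x b (lift p j).
Proof.
move=> /forallP firstp; rewrite /label_tail.
have notp : ~~ ((lift p j <= p)%N && (b p == b (lift p j))).
  apply/negP => /andP[le_jp bp]; have := firstp (lift p j).
  rewrite ltn_neqAle le_jp eq_sym (eq_sym (b _)) bp.
  by rewrite (inj_eq val_inj) neq_lift.
case: (boolP ((lift p j <= p)%N && (b p == b (lift p j)))) => [|_].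
  by rewrite (negPf notp).
rewrite [RHS]big_mkcond (bigD1_ord p) //= (negPf notp) add0n -big_mkcond.
by apply: eq_bigl => k; rewrite leq_bump2.
Qed.

(** The right side is the product of the simplex integrals of the classes. Sort the permutations by
    the position [p] put at the outermost time, necessarily first in its class. Its denominator is
    the sum of all [x j] instead of [label_tail x b p], so [p] contributes the corresponding
    fraction of the product; the fractions add up to 1. *)
Lemma sum_increasing_simplex_coef n (x b : 'I_n -> nat) :
  (forall j, 0 < x j)%N ->
  \sum_(s : 'S_n | increasing_on_labels b s)
     simplex_coef [seq x (s^-1%g k) | k <- enum 'I_n] =
  \prod_(j < n) (label_tail x b j)%:R^-1.
Proof.
elim: n x b => [|n IHn] x b posx.
  rewrite big_ord0 (big_pred1 1%g) ?enum_ord0 //= => s.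
  rewrite /increasing_on_labels; apply/forallP/eqP => [_|_ []//].
  by apply/permP => -[].
have sumx_neq0 : (\sum_(j < n.+1) x j)%:R != 0 :> K.
  rewrite natf_eq0 -lt0n (leq_trans (posx ord0)) //.
  by rewrite big_ord_recl leq_addr.
rewrite (partition_big (fun s : 'S_n.+1 => s^-1%g ord0) (first_of_label b)) /=;
  last first.
  move=> s /forallP incs; apply/forallP => j; apply/implyP => lt_jp.
  apply/negP => bj; have /forallP/(_ (s^-1%g ord0)) := incs j.
  by rewrite lt_jp bj permKV.
transitivity (\sum_(p < n.+1 | first_of_label b p)
   (label_tail x b p)%:R / (\sum_(j < n.+1) x j)%:R * 
     \prod_(j < n.+1) (label_tail x b j)%:R^-1 : K).
  apply: eq_bigr => p firstp; rewrite big_lift_perm.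
  under eq_bigl => s do rewrite increasing_lift_perm firstp /=.
  rewrite [X in _ * X](bigD1_ord p) //= mulrACA.
  have tail_neq0 : (label_tail x b p)%:R != 0 :> K.
    rewrite natf_eq0 -lt0n (leq_trans (posx p)) // /label_tail.
    by rewrite (bigD1 p) ?leqnn ?eqxx //= leq_addr.
  rewrite divff // mul1r.
  under [X in _ * X]eq_bigr => j _ do rewrite -label_tail_lift //.
  rewrite -IHn; last by move=> j; apply: posx.
  rewrite mulr_sumr; apply: eq_bigr => s _.
  rewrite enum_ordSl /= lift_permV lift_perm_id -map_comp.
  rewrite (eq_map (g := fun k => x (lift p (s^-1%g k)))); last first.
    by move=> k /=; rewrite lift_perm_lift.
  rewrite mulrC; congr (_%:R^-1 * _).
  rewrite [RHS](bigD1_ord p) //= sumn_map_ord /=; congr (_ + _)%N.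
  by rewrite [RHS](reindex_inj (@perm_inj _ s^-1%g)).
by rewrite -!mulr_suml -natr_sum sum_first_of_label divff // mul1r.
Qed.

(** * Words, sets of cuts and blocks, in terms of sequences *)

Fixpoint label_coef (w l : seq nat) : K :=
  match w, l with
  | a :: w', q :: l' =>
    label_coef w' l' / (a + sumn (mask (map (pred1 q) l') w'))%:R
  | _, _ => 1
  end.

Lemma prod_label_tail n (x b : 'I_n -> nat) :
  \prod_(j < n) (label_tail x b j)%:R^-1 =
  label_coef [seq x j | j <- enum 'I_n] [seq b j | j <- enum 'I_n].
Proof.
elim: n x b => [|n IHn] x b; first by rewrite big_ord0 enum_ord0.
have first0 : first_of_label b ord0 by apply/forallP.
rewrite enum_ordSl /= big_ord_recl mulrC; congr (_ * _%:R^-1).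
  under eq_bigr => j _ do rewrite -label_tail_lift //.
  by rewrite IHn -!map_comp.
rewrite /label_tail big_mkcond big_ord_recl /= eqxx -big_mkcond /=.
congr (_ + _)%N; transitivity (\sum_(j <- enum 'I_n | b (lift ord0 j) == b ord0)
  x (lift ord0 j))%N; first by rewrite big_enum_cond.
move: (enum _) => e; rewrite -!map_comp.
by rewrite -map_mask -filter_mask sumnE big_map big_filter.
Qed.

(** A bit sequence of length [n] encodes a set of cuts of a word of [n.+1] letters: bit [i] tells
    whether there is a cut after letter [i], counted from 0. *)
Fixpoint bitseqs n : seq (seq bool) :=
  if n is n'.+1 then [seq e :: b | e <- [:: false; true], b <- bitseqs n']
  else [:: [::]].

Lemma big_bitseqsS n (P : pred (seq bool)) (F : seq bool -> K) :
  \sum_(b <- bitseqs n.+1 | P b) F b =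
    \sum_(b <- bitseqs n | P (false :: b)) F (false :: b) +
    \sum_(b <- bitseqs n | P (true :: b)) F (true :: b).
Proof. by rewrite /= cats0 big_cat !big_map. Qed.

Lemma size_bitseqs n b : b \in bitseqs n -> size b = n.
Proof.
elim: n b => [|n IHn] b; first by rewrite inE => /eqP->.
by rewrite /= cats0 mem_cat => /orP[] /mapP[c /IHn <- ->].
Qed.

(* Both sides are \int_{-1}^0 x^d (1 + x)^m dx. *)
Lemma sum_bitseqs_above (D : seq bool) p :
  let d := (p + count id D)%N in let m := count negb D in
  \sum_(b <- bitseqs (size D) | all2 implb D b)
     (-1) ^+ (p + count id b) / (p + count id b).+1%:R =
  (-1) ^+ d * (d`! * m`!)%:R / (d + m).+1`!%:R :> K.
Proof.
elim: D p => [|[] D IHD] p.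
- rewrite /= big_mkcond big_seq1 /= !addn0 muln1 factS natrM invfM mulrA.
  by rewrite [RHS]mulrAC mulfK // natf_eq0 -lt0n fact_gt0.
(* The first bit of [b] is forced and is absorbed into [p]. *)
- rewrite big_bitseqsS /= big_pred0 // add0r.
  under eq_bigr => b _ do rewrite add1n addnS -addSn.
  by rewrite IHD /= !add1n !addnS add0n -addSn.
(* The first bit of [b] is free: x^d (1 + x)^(m+1) = x^d (1 + x)^m + x^(d+1) (1 + x)^m. *)
rewrite big_bitseqsS /=.
under eq_bigr => b _ do rewrite add0n.
under [X in _ + X]eq_bigr => b _ do rewrite add1n addnS -addSn.
rewrite !IHD /= add0n add1n addnS.
rewrite addSn; move: (p + count id D)%N (count negb D) => d m.
rewrite !addSn !factS exprS.
have : (d + m)`!%:R != 0 :> K by rewrite natf_eq0 -lt0n fact_gt0.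
have : (d + m).+1%:R != 0 :> K by rewrite natf_eq0.
have : (d + m).+2%:R != 0 :> K by rewrite natf_eq0.
rewrite !natrM -!natr1 natrD; move: _`!%:R => f sum2_neq0 sum1_neq0 f_neq0.
by field; rewrite f_neq0 sum1_neq0.
Qed.

(** Each letter is labelled by the number of its block, so that the blocks become the classes of the
    shuffle formula. *)
Fixpoint labels q (b : seq bool) : seq nat :=
  q :: if b is e :: b' then labels (q + e)%N b' else [::].

Lemma size_labels q b : size (labels q b) = (size b).+1.
Proof. by elim: b q => [|e b IHb] q //=; rewrite IHb. Qed.

Lemma labels_ge q b : all (leq q) (labels q b).
Proof.
elim: b q => [|e b IHb] q /=; rewrite leqnn //=.
by apply: sub_all (IHb _) => r; apply: leq_trans; rewrite leq_addr.
Qed.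

Lemma nth_labels q b j : (j <= size b)%N ->
  nth 0%N (labels q b) j = (q + count id (take j b))%N.
Proof.
elim: b q j => [|e b IHb] q [|j] //=; rewrite ?addn0 // ltnS => le_jb.
by rewrite IHb // addnA.
Qed.

(** The product of the simplex integrals of the blocks; [v] accumulates the open block, and each bit
    decides whether the next letter of [w] starts a new one. *)
Fixpoint blocks_coef (v w : seq nat) (b : seq bool) : K :=
  match w, b with
  | a :: w', e :: b' =>
    if e then simplex_coef v * blocks_coef [:: a] w' b'
    else blocks_coef (rcons v a) w' b'
  | _, _ => simplex_coef v
  end.

(** As [q] does not recur in [l], the masks for the letters of [v] select nothing in [w]. *)
Lemma label_coef_cat v w q l : q \notin l -> size l = size w ->
  label_coef (v ++ w) (nseq (size v) q ++ l) = simplex_coef v * label_coef w l.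
Proof.
move=> ql szl; elim: v => [|a v IHv] /=; first by rewrite mul1r.
rewrite IHv map_cat map_nseq /= eqxx mask_cat ?size_nseq // mask_true //.
have -> : map (pred1 q) l = nseq (size l) false.
  rewrite -[in RHS](size_map (pred1 q)); apply/all_pred1P/allP.
  by move=> _ /mapP[r rl ->] /=; apply/eqP/negP => /eqP rq; rewrite -rq rl in ql.
by rewrite mask_false cats0 mulrAC.
Qed.

Lemma rcons_nseq (T : Type) (x : T) m : rcons (nseq m x) x = nseq m.+1 x.
Proof. by rewrite -cats1 -(nseqD m 1) addn1. Qed.

(** The open block is [rcons v a], its last letter [a] taking the head [q] of [labels q b]; a cut
    closes it and [label_coef_cat] splits it off. *)
Lemma label_coef_labels v a w b q : size b = size w ->
  label_coef (rcons v a ++ w) (nseq (size v) q ++ labels q b) =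
    blocks_coef (rcons v a) w b.
Proof.
elim: w v a b q => [|a' w IHw] v a [|e b] q //= => [_|[szb]].
  rewrite cats1 rcons_nseq -(size_rcons v a) -[nseq _ _]cats0.
  by rewrite label_coef_cat //= mulr1.
rewrite -[nseq _ _ ++ _]cat_rcons rcons_nseq -(size_rcons v a).
case: e; rewrite ?addn0 ?addn1; last by rewrite -cat_rcons IHw.
rewrite label_coef_cat.
- by rewrite -(IHw [::] a' b q.+1).
- by apply/negP => /(allP (labels_ge _ _)); rewrite ltnn.
by rewrite size_labels szb.
Qed.

(* Sum over the splittings of [w] into [k] nonempty consecutive blocks. *)
Fixpoint split_coef k (w : seq nat) : K :=
  if k is k'.+1 then
    \sum_(j < size w) simplex_coef (take j.+1 w) * split_coef k' (drop j.+1 w)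
  else (w == [::])%:R.

Lemma split_coef_eq0 k w : (size w < k)%N -> split_coef k w = 0.
Proof.
elim: k w => [|k IHk] w //= lt_wk; apply: big1 => j _.
rewrite IHk ?mulr0 // size_drop -ltnS; apply: leq_trans lt_wk.
by rewrite ltnS -subSn // leq_subLR addSn ltnS leq_addl.
Qed.

(** Here [j] counts the letters of [w] that join the open block [v]; the [k] cuts then leave [k]
    blocks in the rest of [w]. *)
Lemma sum_blocks_coef k v w :
  \sum_(b <- bitseqs (size w) | count id b == k) blocks_coef v w b =
    \sum_(j < (size w).+1) simplex_coef (v ++ take j w) * split_coef k (drop j w).
Proof.
elim: w k v => [|a w IHw] k v.
  rewrite big_mkcond big_seq1 big_ord1 /= cats0.
  by case: k => [|k] /=; rewrite ?mulr1 // big_ord0 mulr0.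
rewrite [bitseqs _]/= big_bitseqsS big_ord_recl addrC; congr (_ + _).
  rewrite take0 drop0 cats0; case: k => [|k].
    by rewrite big_pred0 // mulr0.
  under eq_bigl => b do rewrite /= eqSS.
  rewrite /= -mulr_sumr; congr (_ * _).
  by rewrite IHw.
by rewrite /= IHw; apply: eq_bigr => j _; rewrite /= cat_rcons.
Qed.

(** * Descents, and the coefficient of a word in the logarithm *)

Definition descent_bits n (s : 'S_n.+1) : seq bool :=
  mkseq (fun i => s (inord i.+1) < s (inord i))%N n.

Lemma count_descent_bits n (s : 'S_n.+1) : count id (descent_bits s) = descents s.
Proof.
rewrite /descents -sum1_card big_mkcond /= big_ord_recr /=.
rewrite inE; case: existsP => [[j /andP[/eqP jn _]]|_].
  by have := ltn_ord j; rewrite jn ltnn.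
rewrite addn0 -sum1_count big_map big_mkcond /=.
rewrite -{1}(subn0 n) big_mkord; apply: eq_bigr => i _.
rewrite inE; congr (if _ then _ else _).
have lt_in : (i < n)%N := ltn_ord i; have le_in := ltnW lt_in.
have -> : widen_ord (leqnSn n) i = inord i.
  by apply: val_inj; rewrite /= inordK.
apply/idP/existsP => [lt_s|[j /andP[/eqP ji]]].
  by exists (inord i.+1); rewrite lt_s andbT /= !inordK.
suff -> : j = inord i.+1 by [].
by apply: val_inj; rewrite /= ji /= !inordK.
Qed.

(** The blocks are intervals, and [s] increases on an interval exactly when it has no descent
    inside, that is, when every descent is at a cut. *)
Lemma increasing_on_labelsE n (s : 'S_n.+1) b : size b = n ->
  increasing_on_labels (fun j => nth 0%N (labels 0 b) j) s =
    all2 implb (descent_bits s) b.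
Proof.
move=> szb.
have lab j : (j <= n)%N -> nth 0%N (labels 0 b) j = count id (take j b).
  by move=> le_jn; rewrite nth_labels ?szb.
have labS j : (j < n)%N ->
    count id (take j.+1 b) = (count id (take j b) + nth false b j)%N.
  by move=> lt_jn; rewrite (take_nth false) ?szb // -cats1 count_cat /= addn0.
rewrite all2E size_mkseq szb eqxx /=.
apply/forallP/(all_nthP (false, false)) => [incs j|imps i].
  rewrite size_zip size_mkseq szb minnn => lt_jn.
  rewrite nth_zip ?size_mkseq ?szb //= nth_mkseq //.
  apply/implyP => lt_s; apply: contraLR lt_s => bj0.
  have /forallP/(_ (inord j.+1)) := incs (inord j).
  have le_jn := ltnW lt_jn.
  rewrite !inordK ?ltnS // leqnn !lab // labS // (negPf bj0) addn0 eqxx /=.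
  by move=> lt_s; rewrite -leqNgt ltnW.
apply/forallP => j; apply/implyP => /andP[lt_ij /eqP].
have le_in : (i <= n)%N by rewrite -ltnS.
have le_jn : (j <= n)%N by rewrite -ltnS.
rewrite !lab // => eq_lab.
(* By injectivity of [s] a weak inequality suffices, and weak inequalities chain from the trivial
   case of distance 0. *)
rewrite ltn_neqAle (inj_eq val_inj) (inj_eq perm_inj) -(inj_eq val_inj).
rewrite (ltn_eqF lt_ij) /=.
have step k : (k < n)%N -> count id (take k.+1 b) = count id (take k b) ->
    (s (inord k) <= s (inord k.+1))%N.
  move=> lt_kn; rewrite labS // => /eqP; rewrite -[X in _ == X]addn0 eqn_add2l.
  move=> bk0; have := imps k; rewrite size_zip size_mkseq szb minnn => /(_ lt_kn).
  rewrite nth_zip ?size_mkseq ?szb //= nth_mkseq //.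
  by case: nth bk0 => // _; rewrite implybF -leqNgt.
have mono k l : (k <= l <= n)%N -> (count id (take k b) <= count id (take l b))%N.
  case/andP=> le_kl le_ln; rewrite -(subnKC le_kl) takeD count_cat.
  exact: leq_addr.
(* Labels are nondecreasing, so equal labels at both ends force equal labels in between. *)
have climb d : (i + d <= n)%N ->
    count id (take i b) = count id (take (i + d) b) ->
    (s (inord i) <= s (inord (i + d)))%N.
  elim: d => [|d IHd]; rewrite ?addn0 // addnS => lt_idn eq_id.
  have eq_d : count id (take i b) = count id (take (i + d) b).
    have le_idn := ltnW lt_idn.
    apply/eqP; rewrite eqn_leq mono ?leq_addr //= eq_id.
    by rewrite mono // leqnSn.
  apply: (leq_trans (IHd (ltnW lt_idn) eq_d)).
  by apply: (step (i + d)%N lt_idn); rewrite -eq_id.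
by have := climb (j - i)%N; rewrite subnKC ?(ltnW lt_ij) // !inord_val; apply.
Qed.

Lemma strichartz_intE n (i : 'I_n.+1 -> nat) : (forall j, 0 < i j)%N ->
  let w := [seq i j | j <- enum 'I_n.+1] in
  strichartz_int K i =
    (\sum_(k < n.+1) (-1) ^+ k / k.+1%:R * split_coef k.+1 w) *: 'X^(sumn w).
Proof.
move=> posi w.
(* The coefficient takes the Beta integral form of [sum_bitseqs_above], hence becomes a sum over the
   sets of cuts containing the descents. *)
have coefE d : (d <= n)%N -> 
  (-1) ^+ d / (n.+1 * 'C(n, d))%:R =
    (-1) ^+ d * (d`! * (n - d)`!)%:R / n.+1`!%:R :> K.
  move=> le_dn; rewrite factS -(bin_fact le_dn) mulnA.
  rewrite (natrM _ (_ * 'C(_, _))) -mulf_div.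
  by rewrite divff ?mulr1 // natf_eq0 -lt0n muln_gt0 !fact_gt0.
have termE (s : 'S_n.+1) :
  (-1) ^+ descents s / (n.+1 * 'C(n, descents s))%:R *:
    iter_int K [seq (i (s^-1%g k)).-1 | k <- enum 'I_n.+1] =
  (\sum_(b <- bitseqs n | all2 implb (descent_bits s) b)
     (-1) ^+ count id b / (count id b).+1%:R *
     simplex_coef [seq i (s^-1%g k) | k <- enum 'I_n.+1]) *: 'X^(sumn w).
  rewrite (map_comp predn (fun k => i (s^-1%g k))) iter_int_pred; last first.
    by apply/allP => _ /mapP[k _ ->]; apply: posi.
  have -> : sumn [seq i (s^-1%g k) | k <- enum 'I_n.+1] = sumn w.
    rewrite /w !sumn_map_ord.
    by rewrite [RHS](reindex_inj (@perm_inj _ s^-1%g)).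
  rewrite scalerA -mulr_suml; congr (_ * _ *: _).
  have := sum_bitseqs_above (descent_bits s) 0.
  rewrite /= size_mkseq add0n => ->.
  have := count_predC id (descent_bits s); rewrite size_mkseq => cnt.
  have := count_size id (descent_bits s); rewrite size_mkseq => le_dn.
  have -> : count negb (descent_bits s) = (n - count id (descent_bits s))%N.
    by apply/eqP; rewrite -(eqn_add2l (count id (descent_bits s))) subnKC ?cnt.
  by rewrite -count_descent_bits coefE // subnKC.
rewrite /strichartz_int (eq_bigr _ (fun s _ => termE s)) -scaler_suml.
congr (_ *: _); rewrite (exchange_big_dep xpredT) //.
(* For fixed cuts [b] the inner sum runs over the permutations increasing on each block, and the
   shuffle formula applies. *)
transitivity (\sum_(b <- bitseqs n) (-1) ^+ count id b / (count id b).+1%:R *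
  blocks_coef [:: i ord0] (behead w) b).
  rewrite [LHS]big_seq_cond [RHS]big_seq_cond; apply: eq_bigr => b.
  rewrite andbT => /size_bitseqs szb; rewrite -mulr_sumr; congr (_ * _).
  rewrite -(eq_bigl _ _ (fun s => increasing_on_labelsE s szb)).
  rewrite sum_increasing_simplex_coef // prod_label_tail.
  have -> : [seq nth 0%N (labels 0 b) (val j) | j <- enum 'I_n.+1] = labels 0 b.
    by rewrite (map_comp _ val) val_enum_ord -/(mkseq _ _) -szb
       -(size_labels 0) mkseq_nth.
  rewrite -(@label_coef_labels [::] (i ord0) (behead w) b 0).
    by rewrite /w enum_ordSl /=.
  by rewrite size_behead size_map size_enum_ord.
have size_w : size (behead w) = n by rewrite size_behead size_map size_enum_ord.
have w_cons : w = i ord0 :: behead w by rewrite /w enum_ordSl.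
have splitE k : split_coef k.+1 w =
    \sum_(b <- bitseqs n | count id b == k) blocks_coef [:: i ord0] (behead w) b.
  have := sum_blocks_coef k [:: i ord0] (behead w).
  by rewrite {1}size_w => ->; rewrite {1}w_cons.
(* The sets of cuts are sorted by their cardinal [k], which gives [k.+1] blocks. *)
under [RHS]eq_bigr => k _ do rewrite splitE mulr_sumr.
rewrite [RHS](exchange_big_dep xpredT) //= [LHS]big_seq_cond [RHS]big_seq_cond.
apply: eq_bigr => b; rewrite andbT => /size_bitseqs szb.
have lt_bn : (count id b < n.+1)%N by rewrite ltnS -szb count_size.
by rewrite (big_pred1 (Ordinal lt_bn)) // => k; rewrite eq_sym.
Qed.

End Simplex.

(** * Compositions *)

Section Compositions.

Definition incr_head (w : seq nat) : seq nat :=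
  if w is a :: w' then a.+1 :: w' else [::].

(** A first part greater than 1 is lowered by [incr_head] read backwards. The case 1 is separate
    because [incr_head] fixes the empty composition. *)
Fixpoint compositions m : seq (seq nat) :=
  match m with
  | 0 => [:: [::]]
  | 1 => [:: [:: 1%N]]
  | m'.+1 => map (cons 1%N) (compositions m') ++ map incr_head (compositions m')
  end.

Lemma big_compositionsS (V : nmodType) m (F : seq nat -> V) :
  \sum_(w <- compositions m.+1) F w =
    \sum_(a < m.+1) \sum_(w <- compositions (m - a)) F (a.+1 :: w).
Proof.
elim: m F => [|m IHm] F; first by rewrite big_ord1 /= !big_seq1.
rewrite [compositions _]/= big_cat !big_map big_ord_recl subn0.
by congr (_ + _); rewrite IHm.
Qed.

(** Counting occurrences yields membership and the absence of repetitions together. *)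
Lemma count_compositions w m :
  count_mem w (compositions m) = all (leq 1) w && (sumn w == m) :> nat.
Proof.
have count_sum (v : seq nat) s : count_mem v s = \sum_(u <- s) (u == v : nat).
  by elim: s => [|u s IHs]; rewrite ?big_nil ?big_cons //= IHs.
elim: w m => [|a w IHw] [|m]; rewrite count_sum ?big_compositionsS ?big_seq1 //=.
- by rewrite big1 // => a _; rewrite big1.
- by case: a => [|a] //=; rewrite andbF.
transitivity (\sum_(b < m.+1)
    if b.+1 == a then count_mem w (compositions (m - b)) else 0).
  apply: eq_bigr => b _; under eq_bigr => u _ do rewrite eqseq_cons.
  by case: eqP => _ /=; [rewrite count_sum | rewrite big1].
rewrite -big_mkcond /=; case: a => [|a]; first by rewrite big_pred0.
rewrite addSn eqSS; case: (ltnP a m.+1) => [lt_am|le_ma].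
  rewrite (big_pred1 (Ordinal lt_am)) //= IHw.
  by rewrite -{2}(subnKC (lt_am : (a <= m)%N)) eqn_add2l.
rewrite big_pred0 => [|b]; last by rewrite eqSS ltn_eqF ?(leq_trans (ltn_ord b)).
suff -> : (a + sumn w == m)%N = false by rewrite andbF.
by rewrite gtn_eqF // (leq_trans le_ma) ?leq_addr.
Qed.

Lemma mem_compositions w m :
  (w \in compositions m) = all (leq 1) w && (sumn w == m).
Proof. by rewrite -has_pred1 has_count count_compositions lt0b. Qed.

Lemma uniq_compositions m : uniq (compositions m).
Proof.
by apply: count_mem_uniq => w; rewrite count_compositions mem_compositions.
Qed.

Lemma sum_triangle (V : nmodType) m (F : nat -> nat -> V) :
  \sum_(j < m.+1) \sum_(a < j.+1) F j a =
    \sum_(a < m.+1) \sum_(j < (m - a).+1) F (a + j)%N a.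
Proof.
elim: m F => [|m IHm] F; first by rewrite !big_ord1.
rewrite big_ord_recl big_ord1 [RHS]big_ord_recl subn0 (big_ord_recl m.+1) /=.
under eq_bigr => j _ do rewrite big_ord_recl.
rewrite big_split /= addrA; congr (_ + _ + _).
apply: etrans (IHm (fun j a => F j.+1 a.+1)) _; apply: eq_bigr => a _.
by rewrite /bump add1n subSS; apply: eq_bigr => j _; rewrite addSn.
Qed.

(** Concatenation turns the pair [u], [v] into a composition of [m] with a marked cut. An empty [u]
    is the cut at 0; otherwise the first part of [u] is removed and the induction applies. *)
Lemma sum_split_compositions (V : nmodType) m (F : seq nat -> seq nat -> V) :
  \sum_(j < m.+1)
     \sum_(u <- compositions j) \sum_(v <- compositions (m - j)) F u v =
  \sum_(w <- compositions m) \sum_(k < (size w).+1) F (take k w) (drop k w).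
Proof.
have [n] := ubnP m; elim: n => // n IHn in m F *.
case: m => [|m] lt_mn; first by rewrite big_ord1 /= !big_seq1 big_ord1.
rewrite big_ord_recl [in X in X + _]big_seq1 subn0.
under [RHS]eq_bigr => w _ do rewrite big_ord_recl take0 drop0.
rewrite big_split /=; congr (_ + _).
under eq_bigr => j _ do rewrite /bump add1n subSS big_compositionsS.
rewrite (@sum_triangle V m (fun j a => \sum_(u <- compositions (j - a))
  \sum_(v <- compositions (m - j)) F (a.+1 :: u) v)).
rewrite (@big_compositionsS V m (fun w => \sum_(k < size w)
  F (take (bump 0 k) w) (drop (bump 0 k) w))).
apply: eq_bigr => a _.
rewrite -(IHn _ (fun u => F (a.+1 :: u))).
  by apply: eq_bigr => j _; rewrite addKn subnDA.
by apply: leq_ltn_trans (leq_subr _ _) _.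
Qed.

(** The passage to the indexing of [strichartz_log]. For [m = 0] the empty composition would have no
    counterpart with [1 <= n]. *)
Lemma big_compositions_ffun (V : nmodType) m (F : seq nat -> V) : (0 < m)%N ->
  \sum_(w <- compositions m) F w =
    \sum_(1 <= n < m.+1) \sum_(i : {ffun 'I_n -> 'I_m.+1} | is_composition i)
       F [seq (i j : nat) | j <- enum 'I_n].
Proof.
move=> m_gt0.
have size_comp w : w \in compositions m -> (0 < size w < m.+1)%N.
  rewrite mem_compositions => /andP[posw /eqP sumw]; rewrite ltnS -{1}sumw.
  apply/andP; split; first by case: w sumw {posw} => //= m0; rewrite -m0 in m_gt0.
  elim: w posw {sumw} => //= a w IHw /andP[a_gt0 /IHw le_w].
  by rewrite -add1n leq_add.
transitivity (\sum_(1 <= n < m.+1) \sum_(w <- compositions m | size w == n) F w).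
  rewrite (exchange_big_dep xpredT) //= [LHS]big_seq [RHS]big_seq.
  apply: eq_bigr => w /size_comp sz_w; under eq_bigl => n do rewrite eq_sym.
  by rewrite big_nat1_eq sz_w.
apply: eq_big_nat => n _; rewrite -big_filter.
pose word (i : {ffun 'I_n -> 'I_m.+1}) := [seq (i j : nat) | j <- enum 'I_n].
have word_inj : injective word.
  move=> i1 i2 /eq_in_map eq_i; apply/ffunP => j; apply: val_inj.
  by apply: eq_i; rewrite mem_enum.
transitivity (\sum_(w <- map word (enum (@is_composition m n))) F w); last first.
  by rewrite big_map big_enum.
apply: perm_big; apply: uniq_perm.
- exact/filter_uniq/uniq_compositions.
- by rewrite map_inj_uniq // enum_uniq.
move=> w; rewrite mem_filter mem_compositions.
have wordP i : is_composition i = all (leq 1) (word i) && (sumn (word i) == m).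
  rewrite /word sumn_map_ord /is_composition; congr (_ && _).
  by apply/forallP/allP => [pos_i _ /mapP[j _ ->]|pos_i j] //;
    apply: pos_i; apply/mapP; exists j; rewrite ?mem_enum.
apply/and3P/mapP => [[/eqP sz_w pos_w sum_w]|[i]]; last first.
  rewrite mem_enum -[_ \in _]/(is_composition i) wordP => /andP[pos_i sum_i] ->.
  by rewrite size_map size_enum_ord.
have lt_w j : (nth 0%N w j < m.+1)%N.
  rewrite ltnS -(eqP sum_w); elim: w j {sz_w pos_w sum_w} => [|a w IHw] [|j] //=.
    exact: leq_addr.
  exact: leq_trans (IHw j) (leq_addl _ _).
have wE : w = word [ffun j : 'I_n => inord (nth 0%N w j)].
  apply: (@eq_from_nth _ 0%N) => [|j].
    by rewrite /word size_map size_enum_ord.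
  rewrite sz_w => lt_jn.
  rewrite (nth_map (Ordinal lt_jn)) ?size_enum_ord // ffunE inordK //.
  by rewrite nth_enum_ord.
exists [ffun j : 'I_n => inord (nth 0%N w j)] => //.
by rewrite mem_enum -[_ \in _]/(is_composition _) wordP -wE pos_w.
Qed.
End Compositions.

(** * The identity exp (log (1 + X)) = 1 + X modulo X^(N+1) *)

Section TruncatedLog.
Variable K : fieldType.
Hypothesis charK0 : [pchar K] =i pred0.

Definition log1p_poly N : {poly K} :=
  \sum_(k < N) ((-1) ^+ k / k.+1%:R) *: 'X^(k.+1).

Definition exp_log1p_poly N : {poly K} :=
  \sum_(j < N.+1) (j`!%:R^-1) *: log1p_poly N ^+ j.

Lemma log1p_poly_dvdX N : exists p, log1p_poly N = p * 'X.
Proof.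
exists (\sum_(k < N) ((-1) ^+ k / k.+1%:R) *: 'X^k); rewrite mulr_suml.
by apply: eq_bigr => k _; rewrite exprSr scalerAl.
Qed.

(** The derivative is a finite geometric sum. *)
Lemma deriv_log1p_poly N : (1 + 'X) * (log1p_poly N)^`() = 1 - (- 'X) ^+ N.
Proof.
have -> : (log1p_poly N)^`() = \sum_(k < N) (- 'X) ^+ k.
  rewrite raddf_sum; apply: eq_bigr => k _ /=.
  rewrite derivZ derivXn /= -scaler_nat scalerA divfK ?natf_eq0 //.
  by rewrite -scaleN1r exprZn.
by rewrite -[RHS]opprB subrX1 -mulNr opprB opprK.
Qed.

(** The equation (1 + X) E' = E below degree N. Truncating the exponential loses a multiple of P^N,
    and truncating the logarithm changes (1 + X) P' by a multiple of X^N; as X divides P, neither is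
    seen there. *)
Lemma deriv_exp_log1p_poly N i : (i < N)%N ->
  ((1 + 'X) * (exp_log1p_poly N)^`())`_i = (exp_log1p_poly N)`_i.
Proof.
case: N => // N lt_iN; set P := log1p_poly N.+1.
have -> : (exp_log1p_poly N.+1)^`() =
    (exp_log1p_poly N.+1 - N.+1`!%:R^-1 *: P ^+ N.+1) * P^`().
  rewrite /exp_log1p_poly [in RHS]big_ord_recr /= addrK.
  rewrite raddf_sum big_ord_recl /= expr0 derivZ derivC scaler0 add0r mulr_suml.
  apply: eq_bigr => j _; rewrite derivZ deriv_exp /bump /= add1n.
  rewrite -[in LHS]scaler_nat !scalerA -scalerAl mulrC; congr (_ *: _);
    last by rewrite add0n mulrC.
  by rewrite factS natrM invfM mulrA divff ?mul1r ?natf_eq0.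
have [p Pp] := log1p_poly_dvdX N.+1.
rewrite mulrCA deriv_log1p_poly -mul_polyC /P Pp exprMn exprNn.
set E := exp_log1p_poly _; set c := _%:P.
have -> : (E - c * (p ^+ N.+1 * 'X^(N.+1))) * (1 - (-1) ^+ N.+1 * 'X^(N.+1)) =
    E + (- (E * (-1) ^+ N.+1) - c * p ^+ N.+1 * (1 - (-1) ^+ N.+1 * 'X^(N.+1)))
      * 'X^(N.+1) by ring.
by rewrite coefD coefMXn lt_iN addr0.
Qed.

(** The differential equation reads (i+1) e_(i+1) + i e_i = e_i: from e_0 = 1 follow e_1 = 1 and, in
    characteristic zero, the vanishing of the later coefficients. *)
Lemma coef_exp_log1p_poly N i : (i <= N)%N ->
  (exp_log1p_poly N)`_i = (1 + 'X : {poly K})`_i.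
Proof.
have coef0 : (exp_log1p_poly N)`_0 = 1.
  have [p Pp] := log1p_poly_dvdX N.
  rewrite -horner_coef0 /exp_log1p_poly big_ord_recl Pp hornerD horner_sum.
  rewrite big1 => [|j _].
    by rewrite addr0 expr0 invr1 scale1r hornerC.
  by rewrite hornerZ horner_exp hornerM hornerX mulr0 expr0n mulr0.
elim: i => [|i IHi] lt_iN; first by rewrite coef0 coefD coef1 coefX addr0.
have := @deriv_exp_log1p_poly N i lt_iN.
rewrite mulrDl mul1r coefD coefXM !coef_deriv IHi 1?ltnW //.
case: i IHi lt_iN => [|i] IHi lt_iN /=.
  by rewrite addr0 mulr1n => ->; rewrite !coefD !coef1 !coefX add0r addr0.
rewrite IHi 1?ltnW // !coefD !coef1 !coefX /= !add0r => eq_i.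
have : (exp_log1p_poly N)`_i.+2 *+ i.+2 = 0.
  case: i eq_i {IHi lt_iN} => [|i] /=; last by rewrite mul0rn addr0.
  by rewrite mulr1n => /(canRL (addrK _)); rewrite subrr.
by move/eqP; rewrite -(mulr_natr _`_i.+2) mulf_eq0 natf_eq0 // orbF => /eqP.
Qed.

End TruncatedLog.

(** * Sums over words *)

Section WordSums.
Variables (K : fieldType) (A : algType K) (L : nat -> A).
Implicit Types phi psi : seq nat -> K.

(** The head of the word, at the outermost time, is the rightmost factor, as F' = F L requires. *)
Fixpoint word_prod (w : seq nat) : A :=
  if w is a :: w' then word_prod w' * L a else 1.

Lemma word_prod_cat u v : word_prod (u ++ v) = word_prod v * word_prod u.
Proof. by elim: u => [|a u IHu] /=; rewrite ?mulr1 // IHu mulrA. Qed.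

Lemma word_prod_ord n (i : 'I_n -> nat) :
  word_prod [seq i j | j <- enum 'I_n] = \prod_(j < n) L (i (rev_ord j)).
Proof.
elim: n i => [|n IHn] i; first by rewrite enum_ord0 big_ord0.
rewrite enum_ordSl /= -map_comp IHn big_ord_recr /=.
congr (_ * L (i _)); last by apply: val_inj; rewrite /= subnn.
apply: eq_bigr => j _; congr (L (i _)); apply: val_inj => /=.
by rewrite /bump /= add1n subSS -subSn // subSS.
Qed.

Definition word_sum phi m : A :=
  \sum_(w <- compositions m) phi w *: word_prod w.

Lemma word_sum_delta m : word_sum (fun w => (w == [::])%:R) m = (m == 0)%:R.
Proof.
case: m => [|m]; first by rewrite /word_sum big_seq1 scale1r.
rewrite /word_sum big_compositionsS big1 // => a _; rewrite big1 // => w _.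
by rewrite scale0r.
Qed.

(** Products concatenate words; since [word_prod] reverses, the left factor [psi] reads the end of
    the word. *)
Lemma word_sumM phi psi m :
  \sum_(j < m.+1) word_sum psi j * word_sum phi (m - j) =
  word_sum (fun w => \sum_(k < (size w).+1) phi (take k w) * psi (drop k w)) m.
Proof.
transitivity (\sum_(w <- compositions m) \sum_(k < (size w).+1)
    (phi (take k w) * psi (drop k w)) *:
       (word_prod (drop k w) * word_prod (take k w))); last first.
  apply: eq_bigr => w _; rewrite scaler_suml; apply: eq_bigr => k _.
  by rewrite -word_prod_cat cat_take_drop.
rewrite -(@sum_split_compositions _ _ (fun u v =>
  (phi u * psi v) *: (word_prod v * word_prod u))).
rewrite (reindex_inj rev_ord_inj) /=; apply: eq_bigr => j _.
have le_jm : (j <= m)%N by rewrite -ltnS.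
rewrite subSS subKn // mulr_sumr; apply: eq_bigr => u _.
rewrite mulr_suml; apply: eq_bigr => v _.
by rewrite -scalerAl -scalerAr scalerA mulrC.
Qed.

Lemma eq_word_sum phi psi m :
  (forall w, w \in compositions m -> phi w = psi w) ->
  word_sum phi m = word_sum psi m.
Proof.
move=> eq_phi; rewrite /word_sum [LHS]big_seq [RHS]big_seq.
by apply: eq_bigr => w /eq_phi->.
Qed.

End WordSums.

(** * Strichartz' expansion *)

Section Strichartz.
Variables (K : fieldType) (A : algType K) (theta : K) (R : {linear A -> A}).
Hypothesis charK0 : [pchar K] =i pred0.
Variable X : A.

Local Notation F := (atkinson R X).
Local Notation Lambda := (Lpow theta R X).

(** [atkinson_deriv] splits off the head of the word and divides by [m], the sum of all letters, as
    does [simplex_coef]. *)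
Lemma atkinson_word_sum (RB : rota_baxter theta R) m :
  F m = word_sum Lambda (simplex_coef K) m.
Proof.
have [n] := ubnP m; elim: n => // n IHn in m *.
case: m => [|m] lt_mn; first by rewrite /word_sum big_seq1 scale1r.
have mK : m.+1%:R != 0 :> K by rewrite natf_eq0.
apply: (scalerI mK); rewrite scaler_nat (atkinson_deriv X RB).
rewrite /word_sum big_compositionsS scaler_sumr; apply: eq_bigr => a _.
rewrite subSS IHn; last by apply: leq_ltn_trans (leq_subr _ _) _.
rewrite mulr_suml scaler_sumr [LHS]big_seq [RHS]big_seq; apply: eq_bigr => w.
rewrite mem_compositions => /andP[_ /eqP sumw] /=.
have le_am : (a <= m)%N by rewrite -ltnS.
by rewrite sumw addSn subnKC // scalerA mulrC divfK // -scalerAl.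
Qed.

(** The logarithm series stops at [size w], as a word has no more nonempty blocks than letters. *)
Definition log_coef (w : seq nat) : K :=
  \sum_(k < size w) (-1) ^+ k / k.+1%:R * split_coef K k.+1 w.

Lemma strichartz_log_word_sum m :
  strichartz_log theta R X m = word_sum Lambda log_coef m.
Proof.
rewrite /strichartz_log /series_sum.
have termE k n (i : {ffun 'I_n -> 'I_k.+1}) : (0 < n)%N -> is_composition i ->
    strichartz_term theta R X i m =
      (log_coef [seq (i j : nat) | j <- enum 'I_n] *+ (m == k)) *:
       word_prod Lambda [seq (i j : nat) | j <- enum 'I_n].
  case: n i => // n i _ /andP[/forallP posi /eqP sumi].
  rewrite /strichartz_term strichartz_intE // coefZ coefXn word_prod_ord.
  rewrite sumn_map_ord sumi mulr_natr; congr (_ *+ _ *: _).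
  by rewrite /log_coef size_map size_enum_ord.
(* The member of index [k] is a multiple of t^k, so only [k = m] contributes. *)
rewrite big_ord_recr /= big1 ?add0r => [|k _]; last first.
  rewrite big_nat big1 // => n /andP[n_gt0 _]; rewrite big1 // => i comp_i.
  by rewrite termE // gtn_eqF // mulr0n scale0r.
case: m termE => [|m] termE.
  by rewrite big_geq // /word_sum big_seq1 /log_coef big_ord0 scale0r.
rewrite /word_sum big_compositions_ffun //.
apply: eq_big_nat => n /andP[n_gt0 _]; apply: eq_bigr => i comp_i.
by rewrite termE // eqxx mulr1n.
Qed.

Variable N : nat.

(** F - 1 truncated after degree [N], to be substituted in the polynomial identities above. *)
Definition atkinson_tail : {poly A} :=
  \poly_(m < N.+1) (if m == 0%N then 0 else F m).

Lemma coef_atkinson_tailX (RB : rota_baxter theta R) k m : (m <= N)%N ->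
  (atkinson_tail ^+ k)`_m = word_sum Lambda (split_coef K k) m.
Proof.
elim: k m => [|k IHk] m le_mN.
  by rewrite expr0 coef1 word_sum_delta.
(* The last factor carries the first block of the word, the one that [split_coef] removes; blocks
   are nonempty because the tail has no constant term. *)
rewrite exprSr coefM.
transitivity (\sum_(j < m.+1) word_sum Lambda (split_coef K k) j *
  word_sum Lambda (fun w => if w == [::] then 0 else simplex_coef K w) (m - j)).
  apply: eq_bigr => j _; have le_jm : (j <= m)%N by rewrite -ltnS.
  rewrite IHk ?(leq_trans le_jm) //; congr (_ * _).
  rewrite coef_poly ltnS (leq_trans (leq_subr _ _) le_mN).
  case: (m - j)%N => [|l]; first by rewrite /word_sum big_seq1 scale0r.
  rewrite [_ == _](_ : _ = false) // atkinson_word_sum //.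
  apply: eq_word_sum => w.
  by case: w => //; rewrite mem_compositions.
rewrite word_sumM; apply: eq_word_sum => w _ /=.
rewrite big_ord_recl take0 eqxx mul0r add0r; apply: eq_bigr => j _.
by case: w j => [|a w] j //; case: j.
Qed.

(** Scalars are central in [{poly A}], so substituting the tail in [{poly K}] is a ring morphism
    even when [A] is not commutative. *)
Lemma tail_comm : commr_rmorph (polyC \o in_alg A) atkinson_tail.
Proof.
move=> c; apply/polyP => i.
by rewrite coefMC coefCM /= -scalerAr mulr1 -scalerAl mul1r.
Qed.

Local Notation subst := (horner_morph tail_comm).

Lemma coef_substZ c p i : (subst (c *: p))`_i = c *: (subst p)`_i.
Proof.
by rewrite -mul_polyC rmorphM /= horner_morphC coefCM /= -scalerAl mul1r.
Qed.

Lemma coef_subst_mulXn p k i : (i < k)%N -> (subst (p * 'X^k))`_i = 0.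
Proof.
move=> lt_ik; rewrite rmorphM rmorphXn /= horner_morphX.
move: (horner_morph _ p) => q.
have -> : atkinson_tail = drop_poly 1 atkinson_tail * 'X.
  rewrite -{1}(poly_take_drop 1 atkinson_tail) expr1.
  rewrite [take_poly _ _](_ : _ = 0) ?add0r //; apply/polyP => j.
  rewrite coef_take_poly coef0 ltnS leqn0 coef_poly.
  by case: eqP => // ->.
rewrite exprMn_comm; last exact: commr_polyX.
by rewrite mulrA coefMXn lt_ik.
Qed.

Lemma coef_subst_log (RB : rota_baxter theta R) m : (m <= N)%N ->
  (subst (log1p_poly K N))`_m = strichartz_log theta R X m.
Proof.
move=> le_mN; rewrite rmorph_sum coef_sum strichartz_log_word_sum.
transitivity (\sum_(k < N) ((-1) ^+ k / k.+1%:R) *: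
    word_sum Lambda (split_coef K k.+1) m).
  apply: eq_bigr => k _; rewrite coef_substZ rmorphXn /= horner_morphX.
  by rewrite coef_atkinson_tailX.
transitivity (word_sum Lambda (fun w =>
    \sum_(k < N) (-1) ^+ k / k.+1%:R * split_coef K k.+1 w) m).
  rewrite /word_sum; under eq_bigr => k _ do rewrite scaler_sumr.
  rewrite exchange_big /=; apply: eq_bigr => w _; rewrite scaler_suml.
  by apply: eq_bigr => k _; rewrite scalerA.
apply: eq_word_sum => w; rewrite mem_compositions => /andP[posw /eqP sumw].
(* No word of weight [m] has more than [N] letters, so the truncated logarithm contains every term
   of [log_coef]; the others vanish by [split_coef_eq0]. *)
have le_wN : (size w <= N)%N.
  apply: leq_trans le_mN; rewrite -sumw; elim: w posw {sumw} => //= a w IHw.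
  by case/andP=> a_gt0 /IHw le_w; rewrite -add1n leq_add.
pose term k := (-1) ^+ k / k.+1%:R * split_coef K k.+1 w.
rewrite [RHS](big_ord_widen N term) //.
rewrite [RHS]big_mkcond; apply: eq_bigr => k _; case: ltnP => // le_wk.
by rewrite split_coef_eq0 ?mulr0.
Qed.

Lemma coef_subst_logX (RB : rota_baxter theta R) k m : (m <= N)%N ->
  (subst (log1p_poly K N ^+ k))`_m = seriesX (strichartz_log theta R X) k m.
Proof.
elim: k m => [|k IHk] m le_mN; first by rewrite expr0 rmorph1 coef1.
rewrite exprS rmorphM coefM; apply: eq_bigr => j _.
have le_jm : (j <= m)%N by rewrite -ltnS.
rewrite coef_subst_log ?(leq_trans le_jm) // IHk //.
exact: leq_trans (leq_subr _ _) le_mN.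
Qed.

(** The tail is substituted in exp (log (1 + X)) = 1 + X modulo X^(N+1) and the coefficient of
    degree [N] is read off; [N] is both the truncation order and the degree. *)
Lemma series_exp_strichartz_log (RB : rota_baxter theta R) :
  series_exp (strichartz_log theta R X) N = F N.
Proof.
transitivity (subst (exp_log1p_poly K N))`_N.
  rewrite rmorph_sum coef_sum; apply: eq_bigr => k _.
  by rewrite coef_substZ coef_subst_logX.
have -> : exp_log1p_poly K N =
    1 + 'X + drop_poly N.+1 (exp_log1p_poly K N - (1 + 'X)) * 'X^(N.+1).
  rewrite -[LHS](subrK (1 + 'X)) addrC; congr (_ + _).
  rewrite -{1}(poly_take_drop N.+1 (_ - _)) [take_poly _ _](_ : _ = 0) ?add0r //.
  apply/polyP => i; rewrite coef_take_poly coef0; case: ltnP => // lt_iN.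
  by rewrite coefB coef_exp_log1p_poly ?subrr.
rewrite rmorphD coefD coef_subst_mulXn // addr0 rmorphD rmorph1 /=.
rewrite horner_morphX coefD coef1 coef_poly leqnn.
by case: eqP => [->|]; rewrite ?addr0 ?add0r.
Qed.

End Strichartz.

Theorem theorem8p2 (K : fieldType) (charK0 : [pchar K] =i pred0)
    (A : algType K) (theta : K) (R : {linear A -> A})
    (RB : rota_baxter theta R) (X : A) :
  let F := series_exp (strichartz_log theta R X) in
  F =1 series1 A \+ (R \o seriesM F (monomial X 1)).
Proof.
move=> F N.
have FE m : F m = atkinson R X m by apply: series_exp_strichartz_log.
rewrite FE /= /seriesM /monomial /series1.
case: N => [|N]; first by rewrite big_ord1 /= mulr0 linear0 addr0.
(* Only the index [k = N] of the convolution meets the degree 1 of the monomial. *)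
rewrite 2!big_ord_recr big1 /= => [|k _].
  by rewrite subnn subSnn mulr0n mulr0 add0r addr0 mulr1n FE add0r.
by rewrite subSn 1?ltnW // eqSS subn_eq0 leqNgt ltn_ord mulr0.
Qed.
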